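(* For every $n\ge 1$, $$L^{se}_{n^3}-L^{so}_{n^3}=\sum_{A\in B_n}(-1)^{\sigma_0(A)}\,\mathrm{Det}(A)^{n^2}.$$
   Context: A Latin cube of order $n$ is an $n\times n\times n$ array $L=(L_{ijk})$ with entries in $[n^2]$ such that each symbol of $[n^2]$ occurs exactly once in each $i$-slice (fixed $i$), each $j$-slice and each $k$-slice. For each symbol $s$ the positions $(i,j,k)$ with $L_{ijk}=s$ form a set $\{(i,\sigma_s(i),\tau_s(i))\mid i\in[n]\}$ for unique $\sigma_s,\tau_s\in S_n$. The symbol sign of $L$ is $\mathrm{sym}(L)=\prod_{s=1}^{n^2}\mathrm{sgn}(\sigma_s)\,\mathrm{sgn}(\tau_s)$; $L$ is symbol-even if $\mathrm{sym}(L)=+1$ and symbol-odd if $\mathrm{sym}(L)=-1$. $L^{se}_{n^3}$ and $L^{so}_{n^3}$ denote the numbers of symbol-even and symbol-odd Latin cubes of order $n$. $B_n$ is the set of all $n\times n\times n$ arrays with entries in $\{0,1\}$; for $A\in B_n$, $\sigma_0(A)$ is the number of zero entries of $A$. The hyperdeterminant is $\mathrm{Det}(A)=\sum_{\sigma\in S_n}\sum_{\tau\in S_n}\mathrm{sgn}(\sigma)\,\mathrm{sgn}(\tau)\prod_{i=1}^n A_{i,\sigma(i),\tau(i)}$. *)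

(* Defs.v *)
From mathcomp Require Import all_boot all_order all_algebra all_fingroup.

Set Implicit Arguments.
Unset Strict Implicit.
Unset Printing Implicit Defensive.

Import GRing.Theory.
Local Open Scope ring_scope.

(* Indices and symbols are 0-based: 'I_n plays the role of [n]. *)
Definition array3 (T : Type) (n : nat) := {ffun 'I_n * 'I_n * 'I_n -> T}.

Definition is_latin_cube (n : nat) (L : array3 'I_(n ^ 2) n) : bool :=
  [forall s : 'I_(n ^ 2),
    [&& [forall i, #|[set p : 'I_n * 'I_n | L (i, p.1, p.2) == s]| == 1%N],
        [forall j, #|[set p : 'I_n * 'I_n | L (p.1, j, p.2) == s]| == 1%N] &
        [forall k, #|[set p : 'I_n * 'I_n | L (p.1, p.2, k) == s]| == 1%N]]].

Definition symbol_positions (n : nat) (L : array3 'I_(n ^ 2) n)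
    (s : 'I_(n ^ 2)) : {set 'I_n * 'I_n * 'I_n} :=
  [set x | L x == s].

(* The pair (sigma_s, tau_s). It exists and is unique when L is a Latin cube
   (see symbol_permsP); the default (1, 1) is only reached otherwise. *)
Definition symbol_perms (n : nat) (L : array3 'I_(n ^ 2) n)
    (s : 'I_(n ^ 2)) : 'S_n * 'S_n :=
  odflt (1%g, 1%g)
    [pick st : 'S_n * 'S_n |
       symbol_positions L s == [set (i, st.1 i, st.2 i) | i : 'I_n]].

Lemma symbol_permsP (n : nat) (L : array3 'I_(n ^ 2) n) (s : 'I_(n ^ 2))
    (sigma tau : 'S_n) :
  is_latin_cube L ->
  symbol_positions L s = [set (i, sigma i, tau i) | i : 'I_n] <->
  symbol_perms L s = (sigma, tau).
Proof.
move=> /forallP/(_ s)/and3P[/forallP Hi /forallP Hj /forallP Hk].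
have Hi1 i : exists p, [set p : 'I_n * 'I_n | L (i, p.1, p.2) == s] == [set p].
  by have /cards1P[p ->] := Hi i; exists p.
have uniq1 (T : finType) (A : {set T}) : #|A| == 1%N ->
    forall x y, x \in A -> y \in A -> x = y.
  by move=> /cards1P[z ->] x y /set1P -> /set1P ->.
pose f i := xchoose (Hi1 i).
have fP i : [set p : 'I_n * 'I_n | L (i, p.1, p.2) == s] = [set f i].
  exact/eqP/(xchooseP (Hi1 i)).
have Lf i : L (i, (f i).1, (f i).2) == s.
  by have := set11 (f i); rewrite -fP inE.
have inj1 : injective (fun i => (f i).1).
  move=> i i' e.
  have := uniq1 _ _ (Hj (f i).1) (i, (f i).2) (i', (f i').2).
  by rewrite !inE /= {2}e !Lf => /(_ isT isT) [].
have inj2 : injective (fun i => (f i).2).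
  move=> i i' e.
  have := uniq1 _ _ (Hk (f i).2) (i, (f i).1) (i', (f i').1).
  by rewrite !inE /= {2}e !Lf => /(_ isT isT) [].
have uniqst (st st' : 'S_n * 'S_n) :
    symbol_positions L s = [set (i, st.1 i, st.2 i) | i : 'I_n] ->
    symbol_positions L s = [set (i, st'.1 i, st'.2 i) | i : 'I_n] -> st = st'.
  case: st st' => [a b] [a' b'] /= -> /setP e.
  have H i : (a i, b i) = (a' i, b' i).
    have := e (i, a i, b i); rewrite imset_f // => /esym/imsetP[i' _].
    by case=> <- -> ->.
  by congr pair; apply/permP=> i; case: (H i).
rewrite /symbol_perms; case: pickP => [st /eqP Hst | none] /=.
  split=> [Hp | e]; first by apply: uniqst.
  by rewrite Hst e.
have /eqP[] := none (perm inj1, perm inj2).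
apply/setP=> -[[i j] k]; rewrite inE /=; apply/idP/imsetP => [Lijk | [i' _]].
  exists i => //; rewrite !permE.
  have : (j, k) \in [set f i] by rewrite -fP inE.
  by move=> /set1P <-.
by rewrite !permE => -[-> -> ->].
Qed.

Definition sgn (n : nat) (sigma : 'S_n) : int := (-1) ^+ sigma.

Definition symbol_sign (n : nat) (L : array3 'I_(n ^ 2) n) : int :=
  \prod_(s < n ^ 2) (sgn (symbol_perms L s).1 * sgn (symbol_perms L s).2).

Definition num_symbol_even (n : nat) : nat :=
  #|[set L : array3 'I_(n ^ 2) n | is_latin_cube L & symbol_sign L == 1]|.

Definition num_symbol_odd (n : nat) : nat :=
  #|[set L : array3 'I_(n ^ 2) n | is_latin_cube L & symbol_sign L == -1]|.

Definition hyperdet (n : nat) (A : array3 int n) : int :=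
  \sum_(sigma : 'S_n) \sum_(tau : 'S_n)
    sgn sigma * sgn tau * \prod_(i < n) A (i, sigma i, tau i).

(* The arrays with entries in {0, 1}; false encodes 0 and true encodes 1. *)
Definition binary_array (n : nat) := array3 bool n.

Definition int_array (n : nat) (A : binary_array n) : array3 int n :=
  [ffun x => (A x : nat)%:Z].

Definition num_zeros (n : nat) (A : binary_array n) : nat :=
  #|[set x | int_array A x == 0]|.

(* Main.v *)
Require Import Defs.
From mathcomp Require Import all_boot all_order all_algebra all_fingroup.

(** Expanding [Det(A) ^ (n^2)] gives one term for each family [f] assigning to
    every symbol [s] a pair of permutations, that is, a diagonal
    [(i, sigma_s i, tau_s i)] of the cube.  The term is the sign of [f] times
    the product of the entries of [A] over all the cells of these diagonals.
    When the alternating sum over the binary arrays [A] is taken first, it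
    factors over the cells of the cube: a cell met by some diagonal forces its
    entry to be 1 and contributes 1, and a cell met by none contributes
    [1 - 1 = 0] ([sum_sign_prod_cover]).  So only the families whose diagonals
    cover the cube survive, each with its sign.

    There are [n^2] diagonals of [n] cells each and the cube has [n^3] cells, so
    a covering family is a partition of the cube into diagonals
    ([cell_injective]).  Writing [s] in the cells of the [s]-th diagonal turns
    it into a Latin cube, and every Latin cube arises once in this way
    ([imset_perms_of_cube]); the sign of the family is the symbol sign of the
    cube. *)

Import GRing.Theory.
Local Open Scope ring_scope.

Lemma card_diff_sum_sign (T : finType) (P : pred T) (e : T -> int) :
  (forall x, e x = 1 \/ e x = -1) ->
  #|[set x | P x & e x == 1]|%:Z - #|[set x | P x & e x == -1]|%:Z
    = \sum_(x | P x) e x.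
Proof.
move=> e_sign; rewrite (bigID (fun x => e x == 1)) /=; congr (_ + _).
  rewrite (eq_bigr (fun=> 1)) => [|x /andP[_ /eqP]//].
  by rewrite sumr_const cardsE natz.
rewrite (eq_bigr (fun=> -1)) => [|x /andP[_]]; last first.
  by case: (e_sign x) => ->.
rewrite sumr_const cardsE mulNrn natz; congr (- Posz _).
apply: eq_card => x; rewrite !unfold_in /=; congr (_ && _).
by case: (e_sign x) => ->.
Qed.

(** The sum over [A] factors over the points of [X]: with [m] the number of
    preimages of [x], the value [true] of [A x] contributes [1 ^ m] and the
    value [false] contributes [- 0 ^ m], so the factor at [x] is 1 if [x] is
    attained and 0 otherwise. *)
Lemma sum_sign_prod_cover (X J : finType) (h : J -> X) :
  \sum_(A : {ffun X -> bool})
      (-1) ^+ #|[set x | ~~ A x]| * \prod_j (A (h j) : nat)%:Z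
    = [forall x, x \in codom h]%:R :> int.
Proof.
pose m x := #|[pred j | h j == x]|.
pose F x (b : bool) : int := (if b then 1 else -1) * (b : nat)%:Z ^+ m x.
have -> : [forall x, x \in codom h]%:R = \prod_x \sum_b F x b :> int.
  have sumF x : \sum_b F x b = (x \in codom h)%:R.
    rewrite big_bool /F /= expr1n mulr1 mulN1r expr0n.
    have -> : (x \in codom h) = (m x != 0%N).
      rewrite -lt0n; apply/codomP/card_gt0P => [[j ->]|[j]].
        by exists j; rewrite inE.
      by rewrite inE => /eqP <-; exists j.
    by case: (m x).
  rewrite (eq_bigr _ (fun x _ => sumF x)).
  case: forallP => [cov | ncov].
    by rewrite big1 // => x _; rewrite cov.
  have /existsP[x /negPf xN] : [exists x, x \notin codom h].
    by rewrite -negb_forall; apply/forallP.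
  by rewrite (bigD1 x) //= xN mul0r.
rewrite bigA_distr_bigA; apply: eq_bigr => A _.
rewrite big_split /=; congr (_ * _).
  rewrite (bigID (fun x => A x)) /= big1 => [|x ->//].
  rewrite mul1r (eq_bigr (fun=> -1)) => [|x /negPf->//].
  by rewrite prodr_const cardsE.
rewrite (partition_big h xpredT) //=; apply: eq_bigr => x _.
rewrite (eq_bigr (fun=> (A x : nat)%:Z)) => [|j /eqP ->//].
by rewrite prodr_const.
Qed.

Definition perm_family (n : nat) := {ffun 'I_(n ^ 2) -> 'S_n * 'S_n}.

Definition cell {n : nat} (f : perm_family n) (q : 'I_(n ^ 2) * 'I_n) :
    'I_n * 'I_n * 'I_n :=
  (q.2, (f q.1).1 q.2, (f q.1).2 q.2).

Definition covering {n : nat} (f : perm_family n) : bool :=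
  [forall x, x \in codom (cell f)].

Definition family_sign {n : nat} (f : perm_family n) : int :=
  \prod_(s < n ^ 2) (sgn (f s).1 * sgn (f s).2).

Lemma hyperdet_exp {n : nat} (A : array3 int n) :
  hyperdet A ^+ (n ^ 2) =
  \sum_(f : perm_family n) family_sign f * \prod_q A (cell f q).
Proof.
rewrite /hyperdet pair_bigA /= -[in LHS](card_ord (n ^ 2)) -prodr_const.
rewrite bigA_distr_bigA; apply: eq_bigr => f _; rewrite big_split /=.
by congr (_ * _); rewrite pair_bigA.
Qed.

Lemma num_zerosE {n : nat} (A : binary_array n) :
  num_zeros A = #|[set x | ~~ A x]|.
Proof. by apply: eq_card => x; rewrite !inE ffunE; case: (A x). Qed.

Lemma sum_hyperdet_exp (n : nat) :
  \sum_(A : binary_array n) (-1) ^+ num_zeros A * hyperdet (int_array A) ^+ (n ^ 2)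
    = \sum_(f : perm_family n | covering f) family_sign f.
Proof.
under eq_bigr => A _ do rewrite hyperdet_exp mulr_sumr.
rewrite exchange_big [RHS]big_mkcond /=; apply: eq_bigr => f _.
under eq_bigr => A _.
  rewrite mulrCA num_zerosE; under eq_bigr => q _ do rewrite ffunE.
  over.
rewrite -mulr_sumr sum_sign_prod_cover -/(covering f).
by case: (covering f); rewrite ?mulr1 ?mulr0.
Qed.

(** A surjection between finite sets of the same size, [n^2 * n = n^3]. *)
Lemma cell_injective {n : nat} (f : perm_family n) :
  covering f -> injective (cell f).
Proof.
move=> /forallP cov; apply/injectiveP/card_uniqP.
(* It remains to see that the image of [cell f], which is the whole cube by
   [cov], has as many elements as the domain. *)
rewrite size_map -cardT.
rewrite (eq_card (B := {: 'I_n * 'I_n * 'I_n})); last by move=> x; rewrite cov.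
by rewrite !card_prod !card_ord -mulnn.
Qed.

Definition perms_of_cube {n : nat} (L : array3 'I_(n ^ 2) n) : perm_family n :=
  [ffun s => symbol_perms L s].

Lemma family_sign_perms_of_cube {n : nat} (L : array3 'I_(n ^ 2) n) :
  family_sign (perms_of_cube L) = symbol_sign L.
Proof. by apply: eq_bigr => s _; rewrite ffunE. Qed.

Lemma symbol_sign_pm1 {n : nat} (L : array3 'I_(n ^ 2) n) :
  symbol_sign L = 1 \/ symbol_sign L = -1.
Proof.
rewrite /symbol_sign; elim/big_ind: _ => [|x y [->|->] [->|->]|s _].
- by left.
- by left.
- by right.
- by right.
- by left.
by rewrite /sgn -signr_addb; case: (_ (+) _); [right | left].
Qed.

(** Read from right to left, this recovers the entry of [L] in every cell from
    the family of [L] alone, whence the injectivity of [perms_of_cube]. *)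
Lemma mem_cell_perms_of_cube {n : nat} {L : array3 'I_(n ^ 2) n} :
  is_latin_cube L ->
  forall s x, (L x == s) = (x \in [set cell (perms_of_cube L) (s, i) | i : 'I_n]).
Proof.
move=> latL s x.
have /setP/(_ x) := (symbol_permsP s _ _ latL).2 (surjective_pairing _).
rewrite inE => ->; congr (_ \in pred_of_set _).
by apply: eq_imset => i; rewrite /cell ffunE.
Qed.

Lemma perms_of_cube_inj (n : nat) :
  {in [pred L | is_latin_cube L] &, injective (perms_of_cube (n := n))}.
Proof.
move=> L L' latL latL' eqLL'; apply/ffunP=> x; apply/esym/eqP.
by rewrite (mem_cell_perms_of_cube latL') -eqLL' -mem_cell_perms_of_cube.
Qed.

Lemma covering_perms_of_cube {n : nat} (L : array3 'I_(n ^ 2) n) :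
  is_latin_cube L -> covering (perms_of_cube L).
Proof.
move=> latL; apply/forallP=> x.
have := eqxx (L x); rewrite mem_cell_perms_of_cube // => /imsetP[i _ ->].
exact: codom_f.
Qed.

(** Each slice meets the diagonal of [s] exactly once, because [id], [sigma_s]
    and [tau_s] are bijections; the witness in each case is the cell found by
    inverting the relevant one. *)
Lemma latin_of_diagonals {n : nat} (f : perm_family n)
    (L : array3 'I_(n ^ 2) n) :
  (forall s x, (L x == s) = (x \in [set cell f (s, i) | i : 'I_n])) ->
  is_latin_cube L.
Proof.
move=> diagL; apply/forallP=> s.
have diagLE i j k :
    (L (i, j, k) == s) = (j == (f s).1 i) && (k == (f s).2 i).
  rewrite diagL; apply/imsetP/andP => [[i' _ [-> -> ->]] //|[/eqP-> /eqP->]].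
  by exists i.
apply/and3P; split; apply/forallP=> a; apply/cards1P.
- exists ((f s).1 a, (f s).2 a); apply/setP=> -[j k].
  by rewrite !inE diagLE.
- pose i := ((f s).1^-1)%g a.
  exists (i, (f s).2 i); apply/setP=> -[i' k].
  rewrite !inE diagLE xpair_eqE /= eq_sym (can2_eq (permK _) (permKV _)).
  by case: eqP => // ->.
pose i := ((f s).2^-1)%g a.
exists (i, (f s).1 i); apply/setP=> -[i' j].
rewrite !inE diagLE xpair_eqE /= andbC eq_sym (can2_eq (permK _) (permKV _)).
by case: eqP => // ->.
Qed.

(** For a covering family the diagonals are moreover disjoint, so that the
    symbol of the diagonal through a cell is well defined; this is the cube
    sent to the given family. *)
Lemma imset_perms_of_cube (n : nat) :
  [set perms_of_cube L | L in [pred L : array3 'I_(n ^ 2) n | is_latin_cube L]]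
    = [set f | covering f].
Proof.
apply/setP=> f; rewrite inE; apply/imsetP/idP => [[L latL ->]|cov_f].
  exact: covering_perms_of_cube.
have cell_inj := cell_injective _ cov_f.
have ex_q x : exists q, cell f q == x.
  by have /forallP/(_ x)/codomP[q ->] := cov_f; exists q.
pose L : array3 'I_(n ^ 2) n := [ffun x => (xchoose (ex_q x)).1].
have L_cell q : L (cell f q) = q.1.
  by rewrite ffunE; congr fst; apply/cell_inj/eqP/(xchooseP (ex_q _)).
have diagL s x : (L x == s) = (x \in [set cell f (s, i) | i : 'I_n]).
  have /forallP/(_ x)/codomP[[s' i] ->] := cov_f; rewrite L_cell /=.
  apply/eqP/imsetP => [->|[i' _ /cell_inj[-> _]]//].
  by exists i.
have latL := latin_of_diagonals _ _ diagL.
exists L => //; apply/ffunP=> s; rewrite ffunE; apply/esym.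
rewrite [RHS]surjective_pairing; apply/(symbol_permsP _ _ _ latL).
by apply/setP=> x; rewrite inE diagL.
Qed.

Theorem theorem5p4 (n : nat) (hn : (1 <= n)%N) :
  (num_symbol_even n)%:Z - (num_symbol_odd n)%:Z =
  \sum_(A : binary_array n) (-1) ^+ num_zeros A * hyperdet (int_array A) ^+ (n ^ 2).
Proof.
rewrite /num_symbol_even /num_symbol_odd.
rewrite card_diff_sum_sign; last exact: symbol_sign_pm1.
rewrite sum_hyperdet_exp.
transitivity (\sum_(f in [set f : perm_family n | covering f]) family_sign f).
  rewrite -imset_perms_of_cube big_imset /=; last exact: perms_of_cube_inj.
  by apply: eq_bigr => L _; rewrite family_sign_perms_of_cube.
by apply: eq_bigl => f; rewrite inE.
Qed.
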